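(* Let $p\ge 1$ be the number of concurrently running threads and let $c>1$ be a constant. For a MultiQueue with $cp$ sequential priority queues (as described in the context), the expected execution time of each \emph{insert} operation and of each \emph{deleteMin} operation is $O(1)$ plus the time for the single access (insertion, respectively deletion of the minimum) to the sequential priority queue that the operation locked.
   Context: A MultiQueue shared by $p$ threads consists of an array $Q[1],\dots,Q[cp]$ of $cp$ sequential priority queues, where $c$ is a tuning parameter. Each $Q[i]$ has a lock flag, and the current minimum key $Q[i].\min$ of $Q[i]$ is stored so that it can be read without locking. A thread holds at most one lock at a time, so at most $p$ queues are locked at any moment. Locking is attempted by an atomic instruction (e.g. compare-and-swap) that either succeeds or fails without waiting. Insert$(e)$: repeat — choose $i$ uniformly at random among the $cp$ queues and try to lock $Q[i]$ — until the lock attempt succeeds; then perform $Q[i].\mathrm{insert}(e)$ and unlock $Q[i]$. DeleteMin: repeat — choose $i$ and $j$ independently and uniformly at random among the $cp$ queues; if $Q[i].\min > Q[j].\min$ swap $i$ and $j$; try to lock $Q[i]$ — until the lock attempt succeeds; then perform $e := Q[i].\mathrm{deleteMin}$, unlock $Q[i]$, and return $e$. The time of an atomic memory access may be taken to be proportional to the number of threads contending for that memory location.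
   Formalization: Scheduling and workload may depend on the whole observable past but not on the random queue indices of a lock attempt still in progress (otherwise the claim fails); time counts a thread's own steps, each atomic access costing in proportion to the threads contending for it. *)

(* Defs.v *)
From HB Require Import structures.
From mathcomp Require Import all_boot all_order all_algebra.
From mathcomp Require Import all_classical all_reals all_analysis.
Set Implicit Arguments.
Unset Strict Implicit.
Unset Printing Implicit Defensive.
Import Order.TTheory GRing.Theory Num.Theory.
Import numFieldNormedType.Exports.

Local Open Scope classical_set_scope.
Local Open Scope ring_scope.

Definition independent_family d (T : measurableType d) (R : realType)
    (P : probability T R) (I : eqType) (V : Type) (X : I -> T -> V) : Prop :=
  forall (J : seq I) (A : I -> set V), uniq J ->
    P (\bigcap_(k in [set` J]) (X k @^-1` A k)) =
    (\prod_(k <- J) P (X k @^-1` A k))%E.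

Definition uniform_draw d (T : measurableType d) (R : realType)
    (P : probability T R) (n : nat) (X : T -> 'I_n) : Prop :=
  forall i, measurable (X @^-1` [set i]) /\
            P (X @^-1` [set i]) = (n%:R^-1)%:E.

(* A black-box sequential priority queue; [pq_min] is the stored minimum key
   and is [None] (read as +oo) exactly when the queue is empty. The access
   times may depend arbitrarily on the internal state. *)
Record seq_pq (R : realType) (dK : Order.disp_t) (K : orderType dK)
    (E : eqType) (key : E -> K) := SeqPQ {
  pq_state : Type;
  pq_elems : pq_state -> seq E;
  pq_min : pq_state -> option K;
  pq_insert : E -> pq_state -> pq_state;
  pq_deletemin : pq_state -> option E * pq_state;
  pq_insert_time : E -> pq_state -> R;
  pq_deletemin_time : pq_state -> R;
  pq_minP : forall q,
    if pq_min q is Some k then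
      k \in map key (pq_elems q) /\
      {in pq_elems q, forall x, (k <= key x)%O}
    else pq_elems q = [::];
  pq_insertP : forall e q,
    perm_eq (pq_elems (pq_insert e q)) (e :: pq_elems q);
  pq_deleteminP : forall q,
    if pq_deletemin q is (Some e, q') then
      perm_eq (pq_elems q) (e :: pq_elems q') /\
      {in pq_elems q, forall x, (key e <= key x)%O}
    else pq_elems q = [::] /\ pq_elems (pq_deletemin q).2 = [::];
  pq_insert_time_ge0 : forall e q, 0 <= pq_insert_time e q;
  pq_deletemin_time_ge0 : forall q, 0 <= pq_deletemin_time q }.

Inductive operation (E : Type) := Insert of E | DeleteMin.
Arguments DeleteMin {E}.

(* Program counter of a thread: each constructor names the next step. *)
Inductive pc (E K : Type) (n : nat) :=
  | Idle of option E                      (* result of the last operation *)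
  | Choose of operation E
  | ReadFst of 'I_n & 'I_n                (* about to read Q[i].min *)
  | ReadSnd of 'I_n & 'I_n & option K     (* about to read Q[j].min *)
  | TryLock of operation E & 'I_n
  | Access of operation E & 'I_n          (* lock held *)
  | Unlock of option E & 'I_n.            (* lock held *)
Arguments Idle {E K n}.
Arguments Choose {E K n}.
Arguments ReadFst {E K n}.
Arguments ReadSnd {E K n}.
Arguments TryLock {E K n}.
Arguments Access {E K n}.
Arguments Unlock {E K n}.

(* What is observable of a program counter: everything except the random
   indices of an attempt whose lock access has not been performed yet, and the
   minimum read through such an index. A scheduler that knew these could delay
   every lock attempt until another thread has locked the chosen queue. *)
Inductive visible_pc (E : Type) (n : nat) :=
  | VIdle of option E
  | VChoose of operation E
  | VReadFst
  | VReadSnd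
  | VTryLock of operation E
  | VAccess of operation E & 'I_n
  | VUnlock of option E & 'I_n.
Arguments VIdle {E n}.
Arguments VChoose {E n}.
Arguments VReadFst {E n}.
Arguments VReadSnd {E n}.
Arguments VTryLock {E n}.
Arguments VAccess {E n}.
Arguments VUnlock {E n}.

Definition hide (E K : Type) (n : nat) (a : pc E K n) : visible_pc E n :=
  match a with
  | Idle r => VIdle r
  | Choose o => VChoose o
  | ReadFst _ _ => VReadFst
  | ReadSnd _ _ _ => VReadSnd
  | TryLock o _ => VTryLock o
  | Access o k => VAccess o k
  | Unlock r k => VUnlock r k
  end.

(* Shared memory locations: [inl k] is the lock flag of queue k and [inr k] its
   stored minimum. *)
Definition location (n : nat) := ('I_n + 'I_n)%type.

(* The atomic memory access performed by the next step. The access to the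
   sequential queue also refreshes the stored minimum. *)
Definition next_location (E K : Type) (n : nat) (a : pc E K n) :
    option (location n) :=
  match a with
  | Idle _ | Choose _ => None
  | ReadFst i _ => Some (inr i)
  | ReadSnd _ j _ => Some (inr j)
  | TryLock _ k => Some (inl k)
  | Access _ k => Some (inr k)
  | Unlock _ k => Some (inl k)
  end.

(* m > m', with None read as +oo *)
Definition min_gt (dK : Order.disp_t) (K : orderType dK) (m m' : option K) :
    bool :=
  match m, m' with
  | _, None => false
  | None, Some _ => true
  | Some x, Some y => (y < x)%O
  end.

Section MultiQueue.
Context {R : realType} {dK : Order.disp_t} {K : orderType dK} {E : eqType}
  {key : E -> K} (pq : seq_pq R key) {p n : nat}.

Record config := Config {
  thread : 'I_p -> pc E K n;
  locked : 'I_n -> bool;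
  queue : 'I_n -> pq_state pq }.

Record view := View {
  vthread : 'I_p -> visible_pc E n;
  vlocked : 'I_n -> bool;
  vqueue : 'I_n -> pq_state pq }.

Definition view_of (s : config) : view :=
  View (fun t => hide (thread s t)) (locked s) (queue s).

Definition initial (q0 : 'I_n -> pq_state pq) : config :=
  Config (fun=> Idle None) (fun=> false) q0.

(* One step of thread [t]. The operation [o] is used only if [t] is idle, and
   the random pair [ij] only if [t] is choosing; an insertion uses only its
   first component. *)
Definition step (s : config) (t : 'I_p) (o : operation E) (ij : 'I_n * 'I_n) :
    config :=
  let goto a := [eta thread s with t |-> a] in
  match thread s t with
  | Idle _ => Config (goto (Choose o)) (locked s) (queue s)
  | Choose (Insert e) =>
      Config (goto (TryLock (Insert e) ij.1)) (locked s) (queue s)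
  | Choose DeleteMin =>
      Config (goto (ReadFst ij.1 ij.2)) (locked s) (queue s)
  | ReadFst i j =>
      Config (goto (ReadSnd i j (pq_min (queue s i)))) (locked s) (queue s)
  | ReadSnd i j m =>
      let k := if min_gt m (pq_min (queue s j)) then j else i in
      Config (goto (TryLock DeleteMin k)) (locked s) (queue s)
  | TryLock o' k =>
      if locked s k then Config (goto (Choose o')) (locked s) (queue s)
      else Config (goto (Access o' k)) [eta locked s with k |-> true] (queue s)
  | Access (Insert e) k =>
      Config (goto (Unlock None k)) (locked s)
        [eta queue s with k |-> pq_insert e (queue s k)]
  | Access DeleteMin k =>
      let rq := pq_deletemin (queue s k) in
      Config (goto (Unlock rq.1 k)) (locked s) [eta queue s with k |-> rq.2]
  | Unlock r k =>
      Config (goto (Idle r)) [eta locked s with k |-> false] (queue s)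
  end.

(* Contending for a location = having an access to it as next step; the thread
   that performs its access is counted. *)
Definition contention (s : config) (l : location n) : nat :=
  #|[set t | next_location (thread s t) == Some l]%SET|.

Definition access_time (s : config) (t : 'I_p) : R :=
  match thread s t with
  | Access (Insert e) k => pq_insert_time e (queue s k)
  | Access DeleteMin k => pq_deletemin_time (queue s k)
  | _ => 0
  end.

(* [a] is the time of the local work of a step, [b] the time of an atomic
   memory access per contending thread. *)
Definition step_time (a b : R) (s : config) (t : 'I_p) : R :=
  a + (if next_location (thread s t) is Some l then b * (contention s l)%:R
       else 0) + access_time s t.

(* Chooses, from all that could be observed so far, the thread that takes the
   next step and the operation it starts if it is idle. Speeds of threads,
   durations for which locks are held, and workloads are all arbitrary. *)
Definition environment := seq view -> 'I_p * operation E.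

(* [run env q0 u tau] is the sequence of views at times 0, ..., tau together
   with the configuration at time tau, when the draws are [u]: a step at time
   tau has the pair (u (tau, false), u (tau, true)) at its disposal. *)
Fixpoint run (env : environment) (q0 : 'I_n -> pq_state pq)
    (u : nat * bool -> 'I_n) (tau : nat) : seq view * config :=
  if tau is tau'.+1 then
    let: (h, s) := run env q0 u tau' in
    let: (t, o) := env h in
    let s' := step s t o (u (tau', false), u (tau', true)) in
    (rcons h (view_of s'), s')
  else ([:: view_of (initial q0)], initial q0).

Section Execution.
Variables (env : environment) (q0 : 'I_n -> pq_state pq)
  (u : nat * bool -> 'I_n).

Definition history (tau : nat) : seq view := (run env q0 u tau).1.
Definition config_at (tau : nat) : config := (run env q0 u tau).2.
Definition mover (tau : nat) : 'I_p := (env (history tau)).1.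

Definition starts (t : 'I_p) (o : operation E) (tau : nat) : Prop :=
  env (history tau) = (t, o) /\
  exists r, thread (config_at tau) t = Idle r.

Definition finishes (t : 'I_p) (tau : nat) : bool :=
  (mover tau == t) &&
  (if thread (config_at tau) t is Unlock _ _ then true else false).

(* The step at time [tau] is a step of the operation that [t] started at time
   [tau0]. *)
Definition in_operation (t : 'I_p) (tau0 tau : nat) : bool :=
  [&& (tau0 <= tau)%N, mover tau == t &
      [forall sigma : 'I_tau, (tau0 <= sigma)%N ==> ~~ finishes t sigma]].

Definition operation_time (a b : R) (t : 'I_p) (tau0 : nat) : \bar R :=
  (\sum_(0 <= tau <oo | in_operation t tau0 tau)
     (step_time a b (config_at tau) t)%:E)%E.

Definition sequential_access_time (t : 'I_p) (tau0 : nat) : \bar R :=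
  (\sum_(0 <= tau <oo | in_operation t tau0 tau)
     (access_time (config_at tau) t)%:E)%E.

End Execution.
End MultiQueue.

(* Main.v *)
(* Until the lock access of an attempt is performed, nothing visible depends on
   the pair it has drawn: redrawing that pair leaves the history unchanged, so
   that given the history it is still uniform and independent of other draws.
   Hence an attempt succeeds with probability at least ((n - p) / n)^2 =
   (1 - 1/c)^2 because both drawn queues are unlocked with at least that
   probability, and two given threads collide at a memory location with
   probability at most 4 / n because at least one of them has a pending draw, so
   that the expected contention is at most 1 + 4p/n <= 5. A potential that drops
   by one in expectation with each step of the operation bounds the expected
   number of steps. *)
Require Import Defs.
From HB Require Import structures.
From mathcomp Require Import all_boot all_order all_algebra.
From mathcomp Require Import all_classical all_reals all_analysis.
From mathcomp Require Import measurable_realfun zify lra.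
Set Implicit Arguments.
Unset Strict Implicit.
Unset Printing Implicit Defensive.
Import Order.TTheory GRing.Theory Num.Theory.
Import numFieldNormedType.Exports.
Local Open Scope classical_set_scope.
Local Open Scope ring_scope.

(** * Double counting by resampling one coordinate *)

Section Counting.
Variables (X : finType) (n : nat).
Implicit Types (u : {ffun X -> 'I_n}) (S : {set {ffun X -> 'I_n}}).

Definition resample u (x : X) (i : 'I_n) : {ffun X -> 'I_n} :=
  [ffun y => if y == x then i else u y].

(* The map (u, i) |-> (resample u x i, u x) is an involution of S * 'I_n. *)
Lemma card_resample S (x : X) (B : {ffun X -> 'I_n} -> {set 'I_n}) :
  (forall u i, u \in S -> resample u x i \in S) ->
  (forall u i, u \in S -> B (resample u x i) = B u) ->
  (n * #|[set u in S | u x \in B u]| = \sum_(u in S) #|B u|)%N.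
Proof.
move=> Sx Bx.
pose f (ui : {ffun X -> 'I_n} * 'I_n) := (resample ui.1 x ui.2, ui.1 x).
have fK : involutive f.
  move=> [u i]; rewrite /f /=; congr pair; last by rewrite ffunE eqxx.
  by apply/ffunP => y; rewrite !ffunE; case: eqP => // ->.
have fS ui : ((f ui).1 \in S) = (ui.1 \in S).
  apply/idP/idP => [h|]; last exact: Sx.
  by rewrite -[ui]fK; apply: Sx.
have pairS F : (\sum_(ui | ui.1 \in S) F ui.1 ui.2 =
    \sum_(u in S) \sum_(i : 'I_n) F u i)%N.
  by rewrite pair_big /=; apply: eq_bigl => ui; rewrite andbT.
transitivity (\sum_(ui | ui.1 \in S) (ui.2 \in B ui.1))%N; last first.
  rewrite (pairS (fun u i => (i \in B u) : nat)).
  by apply: eq_bigr => u _; rewrite -big_mkcond /= sum1_card.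
rewrite (reindex_inj (inv_inj fK)) /=.
under eq_bigl do rewrite fS.
rewrite (eq_bigr (fun ui : {ffun X -> 'I_n} * 'I_n =>
  (ui.1 x \in B ui.1) : nat)); last first.
  by move=> [u i] /= uS; rewrite Bx.
rewrite (pairS (fun u _ => (u x \in B u) : nat)).
under eq_bigr do rewrite sum_nat_const card_ord.
rewrite -big_distrr /= -big_mkcondr /= sum1dep_card.
by congr (_ * _)%N; apply: eq_card => u; rewrite !inE.
Qed.

End Counting.

(** * Runs and pending draws *)

Section Dynamics.
Context {R : realType} {dK : Order.disp_t} {K : orderType dK} {E : eqType}
  {key : E -> K} {pq : seq_pq R key} {p n : nat}.
Variables (env : environment pq (p := p) (n := n)) (q0 : 'I_n -> pq_state pq).
Implicit Types (u v : nat * bool -> 'I_n) (t : 'I_p) (tau sigma : nat)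
  (s : config pq (p := p) (n := n)).

Local Notation hist := (history env q0).
Local Notation cfg := (config_at env q0).
Local Notation mvr := (mover env q0).

Lemma historyS u tau :
  hist u tau.+1 = rcons (hist u tau) (view_of (cfg u tau.+1)).
Proof. by rewrite /history /config_at /=; case: run => h s; case: env. Qed.

Lemma configS u tau :
  cfg u tau.+1 = step (cfg u tau) (mvr u tau) (env (hist u tau)).2
    (u (tau, false), u (tau, true)).
Proof.
by rewrite /mover /history /config_at /=; case: run => h s /=; case: env.
Qed.

Lemma run_prefix u v tau :
  (forall k b, (k < tau)%N -> u (k, b) = v (k, b)) ->
  run env q0 u tau = run env q0 v tau.
Proof.
elim: tau => //= tau IH uv.
rewrite IH; last by move=> k b kt; apply: uv; apply: ltnW.
by rewrite !uv.
Qed.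

Lemma history_le u v sigma tau : (sigma <= tau)%N ->
  hist u tau = hist v tau -> hist u sigma = hist v sigma.
Proof.
elim: tau => [|tau IH]; first by rewrite leqn0 => /eqP ->.
rewrite leq_eqVlt => /orP[/eqP -> //|st].
rewrite !historyS => /rcons_inj/(congr1 fst) h.
exact: IH st h.
Qed.

Lemma history_view u v tau : hist u tau = hist v tau ->
  view_of (cfg u tau) = view_of (cfg v tau).
Proof.
by case: tau => [//|tau]; rewrite !historyS => /rcons_inj/(congr1 snd).
Qed.

Lemma history_hide u v t tau : hist u tau = hist v tau ->
  Defs.hide (thread (cfg u tau) t) = Defs.hide (thread (cfg v tau) t).
Proof. by move=> /history_view/(congr1 (fun w => vthread w t)). Qed.

Lemma history_mover u v tau : hist u tau = hist v tau -> mvr u tau = mvr v tau.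
Proof. by rewrite /mover => ->. Qed.

Lemma thread_step s t t' o ij : t' != t ->
  thread (step s t o ij) t' = thread s t'.
Proof.
move=> /negPf tt'; rewrite /step.
by case: (thread s t) => [r|[e|]|i j|i j m|o' k|[e|] k|r k] /=;
  rewrite ?tt' //; case: (Defs.locked _ _) => /=; rewrite tt'.
Qed.

Definition choosing (a : pc E K n) := if a is Choose _ then true else false.
Definition trying (a : pc E K n) := if a is TryLock _ _ then true else false.
Definition unlocking (a : pc E K n) := if a is Unlock _ _ then true else false.

(** These are the states between a draw and the lock attempt that uses it, exactly those whose
    indices [hide] conceals. *)
Definition pending (a : pc E K n) :=
  match a with
  | ReadFst _ _ | ReadSnd _ _ _ | TryLock _ _ => true
  | _ => false
  end.

Lemma hide_choosing (a a' : pc E K n) : Defs.hide a = Defs.hide a' ->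
  choosing a = choosing a'.
Proof. by case: a; case: a'. Qed.

Lemma hide_trying (a a' : pc E K n) : Defs.hide a = Defs.hide a' ->
  trying a = trying a'.
Proof. by case: a; case: a'. Qed.

Lemma hide_unlocking (a a' : pc E K n) : Defs.hide a = Defs.hide a' ->
  unlocking a = unlocking a'.
Proof. by case: a; case: a'. Qed.

Lemma hide_pending (a a' : pc E K n) : Defs.hide a = Defs.hide a' ->
  pending a = pending a'.
Proof. by case: a; case: a'. Qed.

(* The time of the last draw of [t] before [tau], and 0 if there is none. *)
Fixpoint draw_time u t tau : nat :=
  if tau is tau'.+1 then
    if (mvr u tau' == t) && choosing (thread (cfg u tau') t) then tau'
    else draw_time u t tau'
  else 0.

(** At [TryLock] one index is left, and for a deletion the minima read decide which of the two. The
    disjunction forgets this choice, so the queue contents never enter the probabilistic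
    estimates. *)
Definition drawn (a : pc E K n) (ij : 'I_n * 'I_n) : bool :=
  match a with
  | ReadFst i j | ReadSnd i j _ => (i == ij.1) && (j == ij.2)
  | TryLock _ k => (k == ij.1) || (k == ij.2)
  | _ => true
  end.

Lemma draw_timeP u t tau : pending (thread (cfg u tau) t) ->
  (draw_time u t tau < tau)%N /\
  drawn (thread (cfg u tau) t)
    (u (draw_time u t tau, false), u (draw_time u t tau, true)).
Proof.
elim: tau => [//|tau IH] /=; rewrite configS.
have [->|mt] /= := eqVneq (mvr u tau) t; last first.
  rewrite thread_step 1?eq_sym // => /IH[lt dr].
  by split => //; apply: ltnW.
move: IH; rewrite /step.
case: (thread (cfg u tau) t) => [r|[e|]|i j|i j m|o' k|[e|] k|r k] //=;
  rewrite ?eqxx //=.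
- by rewrite ltnSn !eqxx.
- by rewrite ltnSn !eqxx.
- by move=> IH _; have [//|lt ->] := IH; split => //; apply: ltnW.
- move=> IH _; have [//|lt /andP[/eqP <- /eqP <-]] := IH.
  by split; [apply: ltnW|case: ifP; rewrite eqxx ?orbT].
- by case: (Defs.locked _ k) => /=; rewrite eqxx.
Qed.

(** Coupling of two executions that differ only in a pending draw of [t]. *)
Definition same_but t s s' : Prop :=
  [/\ forall t', t' != t -> thread s t' = thread s' t',
      Defs.hide (thread s t) = Defs.hide (thread s' t),
      Defs.locked s = Defs.locked s' & queue s = queue s'].

Lemma same_but_view t s s' : same_but t s s' -> view_of s = view_of s'.
Proof.
move=> [st sh sl sq]; rewrite /view_of sl sq; congr View.
by apply/funext => t'; have [->//|/st ->] := eqVneq t' t.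
Qed.

Lemma same_but_step t t' s s' o ij : t' != t -> same_but t s s' ->
  same_but t (step s t' o ij) (step s' t' o ij).
Proof.
move=> t't [st sh sl sq]; split.
- move=> t'' t''t; have [->|t''t'] := eqVneq t'' t'; last first.
    by rewrite !thread_step // st.
  rewrite /step -st // -sl -sq.
  by case: (thread s t') => [r|[e|]|i j|i j m|o' k|[e|] k|r k] /=;
    rewrite ?eqxx //; case: (Defs.locked _ _) => /=; rewrite eqxx.
- by rewrite !thread_step 1?eq_sym.
- rewrite /step -st // -sl -sq.
  by case: (thread s t') => [r|[e|]|i j|i j m|o' k|[e|] k|r k] //=;
    case: ifP.
- rewrite /step -st // -sl -sq.
  by case: (thread s t') => [r|[e|]|i j|i j m|o' k|[e|] k|r k] //=;
    case: ifP.
Qed.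

(* Until the lock attempt is performed, no view depends on the draw. *)
Lemma redraw u v t tau : pending (thread (cfg u tau) t) ->
  (forall k b, k != draw_time u t tau -> u (k, b) = v (k, b)) ->
  [/\ hist u tau = hist v tau, same_but t (cfg u tau) (cfg v tau) &
      draw_time v t tau = draw_time u t tau].
Proof.
elim: tau => [//|tau IH] pe; rewrite !historyS /=.
case: ifPn => [/andP[/eqP mt ch] uv|nch uv].
  (* The draw happens in this very step, so the two executions coincide up to time [tau]. *)
  have /(congr1 fst) h : run env q0 u tau = run env q0 v tau.
    by apply: run_prefix => k b kt; apply: uv; rewrite ltn_eqF.
  have /(congr1 snd) c : run env q0 u tau = run env q0 v tau.
    by apply: run_prefix => k b kt; apply: uv; rewrite ltn_eqF.
  rewrite -/(hist u tau) -/(hist v tau) in h.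
  rewrite -/(cfg u tau) -/(cfg v tau) in c.
  have mv : mvr v tau = t by rewrite /mover -h.
  have sb : same_but t (cfg u tau.+1) (cfg v tau.+1).
    rewrite !configS mv mt -h -c; split.
    - by move=> t' t't; rewrite !thread_step.
    - move: ch; rewrite /step.
      by case: (thread (cfg u tau) t) => [r|[e|]|i j|i j m|o' k|[e|] k|r k] //=;
        rewrite eqxx.
    - move: ch; rewrite /step.
      by case: (thread (cfg u tau) t) => [r|[e|]|i j|i j m|o' k|[e|] k|r k].
    - move: ch; rewrite /step.
      by case: (thread (cfg u tau) t) => [r|[e|]|i j|i j m|o' k|[e|] k|r k].
  by rewrite mv eqxx -c ch -h (same_but_view sb); split.
have pe' : pending (thread (cfg u tau) t).
  move: pe nch; rewrite configS.
  have [->|mt] /= := eqVneq (mvr u tau) t; last by rewrite thread_step 1?eq_sym.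
  rewrite /step.
  case: (thread (cfg u tau) t) => [r|[e|]|i j|i j m|o' k|[e|] k|r k] //=;
    by rewrite eqxx.
have [h sb dv] := IH pe' uv.
have [ltd _] := draw_timeP pe'.
have mv : mvr v tau = mvr u tau by rewrite /mover h.
have chv := hide_choosing (let: And4 _ e _ _ := sb in e).
rewrite mv -chv (negPf nch) dv.
have sb' : same_but t (cfg u tau.+1) (cfg v tau.+1).
  rewrite !configS mv -h -!uv ?gtn_eqF //.
  have [mt|mt] := eqVneq (mvr u tau) t; last exact: same_but_step.
  (* A lock attempt leads to [Choose] or [Access], after which no draw is pending. Hence a step of
     [t] itself is here the read of a minimum, whose result stays hidden. *)
  have ntry : ~~ trying (thread (cfg u tau) t).
    move: pe; rewrite configS mt /step.
    case: (thread (cfg u tau) t) => [r|[e|]|i j|i j m|o' k|[e|] k|r k] //=.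
    by case: (Defs.locked _ k) => /=; rewrite eqxx.
  rewrite mt; case: sb => st sh sl sq; split.
  - by move=> t' t't; rewrite !thread_step // st.
  - move: sh pe' ntry; rewrite /step -sl -sq.
    by case: (thread (cfg u tau) t) => [r|[e|]|i j|i j m|o' k|[e|] k|r k];
    case: (thread (cfg v tau) t)
      => [r'|[e'|]|i' j'|i' j' m'|o'' k'|[e'|] k'|r' k'] //=; rewrite ?eqxx.
  - move: sh pe' ntry; rewrite /step -sl -sq.
    by case: (thread (cfg u tau) t) => [r|[e|]|i j|i j m|o' k|[e|] k|r k];
    case: (thread (cfg v tau) t)
      => [r'|[e'|]|i' j'|i' j' m'|o'' k'|[e'|] k'|r' k'] //=; rewrite ?eqxx.
  - move: sh pe' ntry; rewrite /step -sl -sq.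
    by case: (thread (cfg u tau) t) => [r|[e|]|i j|i j m|o' k|[e|] k|r k];
    case: (thread (cfg v tau) t)
      => [r'|[e'|]|i' j'|i' j' m'|o'' k'|[e'|] k'|r' k'] //=; rewrite ?eqxx.
by rewrite -h (same_but_view sb'); split.
Qed.

Definition held (a : pc E K n) : option 'I_n :=
  match a with
  | Access _ k | Unlock _ k => Some k
  | _ => None
  end.

(** * Locks *)

(** Uniqueness of the holder is part of the invariant because a release clears the flag, which is
    sound only if no other thread holds the same lock. *)
Definition mutex s : Prop :=
  (forall k, Defs.locked s k <-> exists t, held (thread s t) = Some k) /\
  (forall t t' k, held (thread s t) = Some k -> held (thread s t') = Some k ->
    t = t').

Lemma mutex_goto s s' t :
  (forall t', t' != t -> thread s' t' = thread s t') ->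
  held (thread s' t) = held (thread s t) -> Defs.locked s' = Defs.locked s ->
  mutex s -> mutex s'.
Proof.
move=> st st' sl.
have sh t' : held (thread s' t') = held (thread s t').
  by have [->|/st ->] := eqVneq t' t.
move=> [lh hu]; split => [k|t1 t2 k]; last by rewrite !sh; apply: hu.
by rewrite sl; split => [/lh[t' h]|[t' h]]; [exists t'|apply/lh; exists t'];
  rewrite ?sh // -sh.
Qed.

Lemma mutex_acquire s s' t k :
  (forall t', t' != t -> thread s' t' = thread s t') ->
  held (thread s t) = None -> held (thread s' t) = Some k ->
  ~~ Defs.locked s k -> Defs.locked s' = [eta Defs.locked s with k |-> true] ->
  mutex s -> mutex s'.
Proof.
move=> st h h' /negP nl sl [lh hu].
have nk t' : held (thread s t') <> Some k.
  by move=> e; apply: nl; apply/lh; exists t'.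
have hk t' k' : held (thread s' t') = Some k' ->
    (t' = t /\ k' = k) \/ (t' <> t /\ held (thread s t') = Some k').
  have [->|t't] := eqVneq t' t; first by rewrite h' => -[->]; left.
  by rewrite st // => ->; right; split => //; apply/eqP.
split.
  move=> k'; rewrite sl /=; have [->|k'k] := eqVneq k' k.
    by split => // _; exists t.
  split => [/lh[t' e]|[t' /hk[[_ /eqP]|[_ e]]]].
  - exists t'; rewrite st //; apply: contra_eq_neq e => ->.
    by rewrite h.
  - by rewrite (negPf k'k).
  - by apply/lh; exists t'.
move=> t1 t2 k' /hk[[-> ->]|[_ e1]] /hk[[-> e2]|[_ e2]] //.
- by case: (nk _ e2).
- by case: (nk t1); rewrite -e2.
- exact: hu e1 e2.
Qed.

Lemma mutex_release s s' t k :
  (forall t', t' != t -> thread s' t' = thread s t') ->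
  held (thread s t) = Some k -> held (thread s' t) = None ->
  Defs.locked s' = [eta Defs.locked s with k |-> false] ->
  mutex s -> mutex s'.
Proof.
move=> st h h' sl [lh hu].
have hk t' k' : held (thread s' t') = Some k' ->
    t' != t /\ held (thread s t') = Some k'.
  by have [->|t't] := eqVneq t' t; [rewrite h'|rewrite st].
split.
  move=> k'; rewrite sl /=; have [->|k'k] := eqVneq k' k.
    split => // -[t' /hk[/eqP t't e]]; case: t't; exact: hu e h.
  split => [/lh[t' e]|[t' /hk[_ e]]]; last by apply/lh; exists t'.
  exists t'; rewrite st //; apply: contra_neq k'k => t't.
  by move: e; rewrite t't h => -[].
by move=> t1 t2 k' /hk[_ e1] /hk[_ e2]; apply: hu e1 e2.
Qed.

Lemma mutex_step s t o ij : mutex s -> mutex (step s t o ij).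
Proof.
have st t' : t' != t -> thread (step s t o ij) t' = thread s t'.
  exact: thread_step.
case e : (thread s t) => [r|[e'|]|i j|i j m|o' k|[e'|] k|r k];
  try by apply: (mutex_goto st); rewrite /step e //= eqxx.
  have [lk|lk] := boolP (Defs.locked s k).
    by apply: (mutex_goto st); rewrite /step e lk //= eqxx.
  by apply: (@mutex_acquire _ _ _ k st);
    rewrite ?e // /step e (negPf lk) //= eqxx.
by apply: (@mutex_release _ _ _ k st); rewrite ?e // /step e //= eqxx.
Qed.

Lemma mutex_config u tau : mutex (cfg u tau).
Proof.
elim: tau => [|tau IH]; last by rewrite configS; apply: mutex_step.
by split => // k; split => // -[].
Qed.

(** The locked queues lie in the image of the threads under [held]. *)
Lemma card_locked s : mutex s -> (#|[set k | Defs.locked s k]%SET| <= p)%N.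
Proof.
move=> [lh _]; rewrite -(card_imset _ Some_inj) -[leqRHS]card_ord.
apply: (@leq_trans #|[set held (thread s t) | t : 'I_p]%SET|);
  last exact: leq_imset_card.
apply: subset_leq_card; apply/fintype.subsetP => x /imsetP[k].
rewrite inE => /lh[t e] ->.
by apply/imsetP; exists t.
Qed.

(** A thread that accesses memory without a pending draw holds the lock of the queue concerned, and
    two threads cannot hold the same lock. *)
Lemma collision_pending s t t' : mutex s -> t != t' ->
  next_location (thread s t) = next_location (thread s t') ->
  next_location (thread s t) -> pending (thread s t) || pending (thread s t').
Proof.
move=> [_ hu] tt'; have := hu t t'.
case: (thread s t) => [r|[e|]|i j|i j m|o' k|o' k|r k];
  case: (thread s t') => [r'|[e'|]|i' j'|i' j' m'|o'' k'|o'' k'|r' k'] //=;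
  by move=> /(_ k) h [kk]; rewrite kk in h; move: tt'; rewrite h ?eqxx.
Qed.

(** Forgetting whether the flag or the minimum is accessed turns a collision into membership of a
    drawn index in a set with at most one element. *)
Definition target (a : pc E K n) : {set 'I_n} :=
  match next_location a with
  | Some (inl k) | Some (inr k) => [set k]%SET
  | None => finset.set0
  end.

Lemma card_target (a : pc E K n) : (#|target a| <= 1)%N.
Proof.
by rewrite /target; case: next_location => [[]|] *; rewrite ?cards1 ?cards0.
Qed.

Lemma drawn_target (a a' : pc E K n) ij : pending a -> drawn a ij ->
  next_location a = next_location a' ->
  (ij.1 \in target a') || (ij.2 \in target a').
Proof.
rewrite /target => pa da <-; move: pa da.
case: a => [r|o|i j|i j m|o' k|o' k|r k] //= _; rewrite !inE.
- by move=> /andP[/eqP -> _]; rewrite eqxx.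
- by move=> /andP[_ /eqP ->]; rewrite eqxx orbT.
- by rewrite ![k == _]eq_sym.
Qed.

(** * Uniformity of pending draws *)

Section Draws.
Variables (i0 : 'I_n) (N : nat).
Local Notation draws := {ffun 'I_N * bool -> 'I_n}.

(** The default [i0] is used from time [N] on, and configurations up to time [N] do not depend on
    it. *)
Definition extend (w : draws) (kb : nat * bool) : 'I_n :=
  if insub kb.1 is Some k then w (k, kb.2) else i0.

Lemma extend_resample (w : draws) (x : 'I_N * bool) (i : 'I_n) kb :
  kb != (val x.1, x.2) -> extend (resample w x i) kb = extend w kb.
Proof.
case: x kb => [x b] [k b']; rewrite /extend /=; case: insubP => //= k' _ <- h.
by rewrite ffunE; case: eqP => // -[kx bx]; rewrite kx bx eqxx in h.
Qed.

Lemma sum_fiber (S : {set draws}) (f : draws -> nat) (F : draws -> nat) :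
  (forall w, w \in S -> f w < N)%N ->
  (\sum_(w in S) F w = \sum_(k < N) \sum_(w in S | f w == k) F w)%N.
Proof.
move=> fN; rewrite (exchange_big_dep (fun w => w \in S)) /=; last first.
  by move=> k w _ /andP[].
apply: eq_bigr => w wS; rewrite (big_pred1 (Ordinal (fN w wS))) // => k.
by rewrite /= wS /= eq_sym.
Qed.

(** Only one component of the pair changes, so that the two components can be redrawn one after the
    other. *)
Definition redrawn t tau b u v : Prop :=
  pending (thread (cfg u tau) t) /\
  forall kb, kb != (draw_time u t tau, b) -> u kb = v kb.

Lemma redrawnP t tau b u v : redrawn t tau b u v ->
  [/\ hist u tau = hist v tau, same_but t (cfg u tau) (cfg v tau) &
      draw_time v t tau = draw_time u t tau].
Proof.
move=> [pe uv]; apply: redraw => // k b' kd; apply: uv.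
by apply: contra kd => /eqP[-> _].
Qed.

(** The position of the pending draw is itself random. On each fiber of [draw_time] it is constant,
    and the fiber is closed under redrawing by [redrawnP], so [card_resample] applies fiber by
    fiber. *)
Lemma card_draw tau t b (G : (nat * bool -> 'I_n) -> bool)
    (B : (nat * bool -> 'I_n) -> {set 'I_n}) : (tau <= N)%N ->
  (forall u v, redrawn t tau b u v -> G u = G v) ->
  (forall u v, redrawn t tau b u v -> B u = B v) ->
  let S := [set w : draws | G (extend w) &&
                            pending (thread (cfg (extend w) tau) t)]%SET in
  (n * #|[set w in S | extend w (draw_time (extend w) t tau, b)
                         \in B (extend w)]%SET| =
   \sum_(w in S) #|B (extend w)|)%N.
Proof.
move=> tN GP BP S.
pose dt (w : draws) := draw_time (extend w) t tau.
have dtN w : w \in S -> (dt w < N)%N.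
  by rewrite inE => /andP[_ /draw_timeP[lt _]]; apply: leq_trans tN.
rewrite (sum_fiber _ dtN) -sum1_card.
rewrite (@sum_fiber _ dt); last by move=> w; rewrite inE => /andP[/dtN].
rewrite big_distrr /=; apply: eq_bigr => k _.
pose Sk := [set w in S | dt w == k]%SET.
have rd w i : w \in Sk ->
    redrawn t tau b (extend w) (extend (resample w (k, b) i)).
  rewrite !inE => /andP[/andP[_ pe] /eqP dtk]; split => // kb.
  by rewrite -/(dt w) dtk => kbn; rewrite extend_resample.
have := @card_resample _ _ Sk (k, b) (fun w => B (extend w)).
have -> : (\sum_(w in S | dt w == k) #|B (extend w)| =
           \sum_(w in Sk) #|B (extend w)|)%N.
  by apply: eq_bigl => w; rewrite [RHS]inE.
move=> <-; last 2 first.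
- move=> w i wS; have [h [_ sh _ _] d] := redrawnP (rd w i wS).
  have := wS; rewrite !inE /dt d -(GP _ _ (rd w i wS)).
  by rewrite (hide_pending sh).
- by move=> w i /rd /BP.
rewrite sum1dep_card; congr (_ * _)%N; apply: eq_card => w.
rewrite !inE -!andbA; do 2 congr (_ && _); rewrite andbC.
have [/eqP dtk|//] := boolP (dt w == k).
rewrite /= -/(dt w) dtk /extend /=.
by rewrite valK.
Qed.

(** The counterpart of measurability with respect to the history: conditioning on such events does
    not bias a pending draw. *)
Definition determined tau (G : (nat * bool -> 'I_n) -> bool) : Prop :=
  forall u v, hist u tau = hist v tau -> G u = G v.

(** The target of [t'] does not change when the draw of [t] is redrawn, so each of the two
    components hits it with probability at most [1 / n]. The factor 2 is the union bound. *)
Lemma collision tau t t' G : (tau <= N)%N -> determined tau G -> t != t' ->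
  (n * #|[set w : draws | [&& G (extend w),
            pending (thread (cfg (extend w) tau) t) &
            next_location (thread (cfg (extend w) tau) t) ==
            next_location (thread (cfg (extend w) tau) t')]]%SET| <=
   2 * #|[set w : draws | G (extend w)]%SET|)%N.
Proof.
move=> tN dG tt'.
pose B u := target (thread (cfg u tau) t').
pose S := [set w : draws | G (extend w) &&
                            pending (thread (cfg (extend w) tau) t)]%SET.
have cB b : (n * #|[set w in S | extend w (draw_time (extend w) t tau, b)
                      \in B (extend w)]%SET| <=
             #|[set w : draws | G (extend w)]%SET|)%N.
  rewrite (card_draw tN) //.
  - apply: (@leq_trans #|S|).
      by rewrite -sum1_card; apply: leq_sum => w _; apply: card_target.
    apply: subset_leq_card; apply/fintype.subsetP => w.
    by rewrite !inE => /andP[].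
  - by move=> u v /redrawnP[/dG].
  - by move=> u v /redrawnP[_ [st _ _ _] _]; rewrite /B st // eq_sym.
rewrite mul2n -addnn; apply: leq_trans (leq_add (cB false) (cB true)).
rewrite -mulnDr leq_mul2l; apply/orP; right.
apply: leq_trans (leq_card_setU _ _).
apply: subset_leq_card; apply/fintype.subsetP => w.
rewrite !inE => /and3P[Gw pe /eqP nl].
rewrite Gw pe /=; have [_ dr] := draw_timeP pe.
exact: drawn_target pe dr nl.
Qed.

Definition own_contention s t : nat :=
  if next_location (thread s t) is Some l then contention s l else 0.

Lemma sum_contention tau t G : (tau <= N)%N -> determined tau G ->
  (n * \sum_(w : draws | G (extend w)) own_contention (cfg (extend w) tau) t <=
   (n + 4 * p) * #|[set w : draws | G (extend w)]%SET|)%N.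
Proof.
move=> tN dG; set g := #|_|.
pose hit t' (w : draws) :=
  next_location (thread (cfg (extend w) tau) t) &&
  (next_location (thread (cfg (extend w) tau) t) ==
   next_location (thread (cfg (extend w) tau) t')).
have -> : (\sum_(w : draws | G (extend w))
             own_contention (cfg (extend w) tau) t =
           \sum_(t' < p) #|[set w : draws | G (extend w) && hit t' w]%SET|)%N.
  under [RHS]eq_bigr do rewrite -sum1dep_card big_mkcondr /=.
  rewrite exchange_big /=; apply: eq_bigr => w _.
  rewrite /own_contention /contention /hit -big_mkcond /=.
  case: next_location => [l|] /=; last by rewrite big_pred0.
  by rewrite sum1dep_card; apply: eq_card => t'; rewrite !inE eq_sym.
(* The thread itself accounts for the summand [n], the other threads for [4 * p]. *)
rewrite (bigD1 t) //= mulnDr mulnDl leq_add //.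
  by rewrite leq_mul2l subset_leq_card ?orbT //; apply/fintype.subsetP => w;
    rewrite !inE => /andP[].
rewrite big_distrr /=.
apply: (@leq_trans (\sum_(t' < p | t' != t) 4 * g)%N); last first.
  rewrite sum_nat_const [(4 * p)%N]mulnC -mulnA leq_mul2r; apply/orP; right.
  by rewrite -[leqRHS]card_ord max_card.
apply: leq_sum => t' t't.
(* One of the colliding threads has a pending draw; each of the two cases costs 2. *)
rewrite -[4%N]/(2 + 2)%N mulnDl.
have tt' : t != t' by rewrite eq_sym.
have c1 := collision tN dG t't; have c2 := collision tN dG tt'.
apply: leq_trans (leq_add c1 c2).
rewrite -mulnDr leq_mul2l; apply/orP; right.
apply: leq_trans (leq_card_setU _ _).
apply: subset_leq_card; apply/fintype.subsetP => w.
rewrite !inE => /and3P[-> nl /eqP e] /=.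
have := collision_pending (mutex_config _ _) _ e nl.
rewrite eq_sym t't e eqxx !andbT => /(_ isT).
by rewrite orbC.
Qed.

Definition free s t : bool :=
  if thread s t is TryLock _ k then ~~ Defs.locked s k else false.

(** The attempt succeeds if both drawn queues are unlocked. Redrawing the components in turn gives
    one factor [(n - p) / n] for each. *)
Lemma sum_free tau t G : (tau <= N)%N -> determined tau G ->
  (forall u, G u -> trying (thread (cfg u tau) t)) ->
  ((n - p) ^ 2 * #|[set w : draws | G (extend w)]%SET| <=
   n ^ 2 * #|[set w : draws | G (extend w) &&
                              free (cfg (extend w) tau) t]%SET|)%N.
Proof.
move=> tN dG Gt.
pose L u := [set k | Defs.locked (cfg u tau) k]%SET.
have LP b u v : redrawn t tau b u v -> ~: L u = ~: L v.
  by move=> /redrawnP[_ [_ _ sl _] _]; rewrite /L sl.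
have cL u : (n - p <= #|~: L u|)%N.
  rewrite cardsCs finset.setCK card_ord leq_sub2l // card_locked //.
  exact: mutex_config.
(* This event depends on the hidden first component and so need not be [determined]. It is invariant
   under redrawing the second component, which is all that [card_draw] asks for. *)
pose G1 u := G u && (u (draw_time u t tau, false) \in ~: L u).
have GP u v : redrawn t tau false u v -> G u = G v by move/redrawnP => -[/dG].
have c1 := card_draw tN GP (LP false).
have G1P u v : redrawn t tau true u v -> G1 u = G1 v.
  move=> r; have [h _ d] := redrawnP r.
  rewrite /G1 (dG _ _ h) (LP _ _ _ r) d; case: r => _ ->//.
  by apply/eqP => -[].
have c2 := card_draw tN G1P (LP true).
have pe u : G u -> pending (thread (cfg u tau) t).
  by move/Gt; case: (thread _ t).
set S := [set w : draws | G (extend w)]%SET.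
set S2 := [set w : draws | G (extend w) && free (cfg (extend w) tau) t]%SET.
move: c1 c2 => /=.
set S1 := (X in (n * #|pred_of_set X|)%N = _ -> _) => c1.
set S3 := (X in (n * #|pred_of_set X|)%N = _ -> _) => c2.
have l1 : ((n - p) * #|S| <= n * #|S1|)%N.
  rewrite c1 mulnC -sum_nat_const.
  apply: (@leq_trans (\sum_(w in S) #|~: L (extend w)|)%N).
    by apply: leq_sum => w _.
  apply: eq_leq; apply: eq_bigl => w; rewrite !inE.
  by have [/pe ->|] := boolP (G (extend w)).
have l2 : ((n - p) * #|S1| <= n * #|S2|)%N.
  apply: (@leq_trans (n * #|S3|)%N).
    rewrite c2 mulnC -sum_nat_const.
  apply: (@leq_trans (\sum_(w in S1) #|~: L (extend w)|)%N).
      by apply: leq_sum => w _.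
    apply: eq_leq; apply: eq_bigl => w; rewrite !inE /G1 !inE.
    by rewrite -!andbA; congr (_ && _); rewrite andbC.
  rewrite leq_mul2l subset_leq_card ?orbT //; apply/fintype.subsetP => w.
  rewrite !inE /G1 !inE => /andP[/andP[/andP[Gw l0] pw] l1'].
  rewrite Gw /free; have := Gt _ Gw; have [_] := draw_timeP pw.
  case: (thread _ t) => //= o k kd _.
  by case/orP: kd => /eqP ->.
rewrite !expnS !expn0 !muln1 -!mulnA.
apply: leq_trans (_ : (n - p) * (n * #|S1|) <= _)%N.
  by rewrite leq_mul2l l1 orbT.
by rewrite mulnCA leq_mul2l l2 orbT.
Qed.

(** The next mover is a function of the history, and being about to unlock is visible. *)
Lemma in_operation_determined t tau0 tau :
  determined tau (fun u => in_operation env q0 u t tau0 tau).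
Proof.
move=> u v h; rewrite /in_operation (history_mover h); do 2 congr (_ && _).
apply: eq_forallb => s; congr (_ ==> ~~ _).
have hs : hist u s = hist v s by apply: history_le h; apply: ltnW.
rewrite /finishes (history_mover hs); congr (_ && _).
exact: hide_unlocking (history_hide t hs).
Qed.

(** * Expected number of steps *)

(* One plus an upper bound for the expected number of remaining steps: [x - 2]
   exceeds the four steps of an attempt divided by its success probability. *)
Definition potential (x : R) (a : pc E K n) : R :=
  match a with
  | Idle _ => x + 1
  | Choose _ => x
  | ReadFst _ _ => x - 1
  | ReadSnd _ _ _ => x - 2
  | TryLock _ _ => x - 3
  | Access _ _ => 2
  | Unlock _ _ => 1
  end.

(** Stopped at 0 once the operation has finished, since the thread may start further operations. *)
Definition remaining (x : R) u t tau0 tau : R :=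
  if [forall sigma : 'I_tau, (tau0 <= sigma)%N ==>
        ~~ finishes env q0 u t sigma]
  then potential x (thread (cfg u tau) t) else 0.

Lemma remaining_ge0 (x : R) u t tau0 tau : 6 <= x ->
  0 <= remaining x u t tau0 tau.
Proof.
move=> x6; rewrite /remaining; case: ifP => // _.
by case: (thread _ t) => //= *; lra.
Qed.

(** Every step except a lock attempt lowers the potential by at least one. A failed attempt moves it
    from [x - 3] to [x], a successful one from [x - 3] to 2; the last term corrects both cases
    exactly. *)
Lemma remaining_step (x : R) u t tau0 tau : 6 <= x -> (tau0 <= tau)%N ->
  (in_operation env q0 u t tau0 tau)%:R + remaining x u t tau0 tau.+1 <=
  remaining x u t tau0 tau +
  (in_operation env q0 u t tau0 tau && trying (thread (cfg u tau) t))%:R *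
    (4 - (x - 2) * (free (cfg u tau) t)%:R).
Proof.
move=> x6 t0; rewrite /remaining /in_operation t0 /=.
set run := [forall sigma : 'I_tau, _].
have -> : [forall sigma : 'I_tau.+1, (tau0 <= sigma)%N ==>
             ~~ finishes env q0 u t sigma] = run && ~~ finishes env q0 u t tau.
  apply/forallP/andP => [h|[/forallP h nf] s].
    split; last by have := h ord_max; rewrite /= t0.
    by apply/forallP => s; have := h (widen_ord (leqnSn _) s).
  have [st|st] := ltnP s tau; first exact: h (Ordinal st).
  have -> : nat_of_ord s = tau.
    by apply/eqP; rewrite eqn_leq st andbT -ltnS.
  by rewrite nf implybT.
case: run; last by rewrite !andbF /= mul0r !addr0.
rewrite /finishes configS /= !andbT.
have [->|mt] /= := eqVneq (mvr u tau) t; last first.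
  by rewrite thread_step 1?eq_sym // mul0r add0r addr0.
rewrite /step /free.
case: (thread (cfg u tau) t) => [r|[e|]|i j|i j m|o k|[e|] k|r k] //=;
  rewrite ?eqxx /= ?mul0r ?addr0 ?mul1r; try by lra.
by case: (Defs.locked (cfg u tau) k) => /=; rewrite eqxx /=; lra.
Qed.

(** Telescoping of [remaining_step], starting from the potential [x + 1] of an idle thread. *)
Lemma sum_in_operation (x : R) u t tau0 m : 6 <= x -> (tau0 <= m)%N ->
  (exists r, thread (cfg u tau0) t = Idle r) ->
  \sum_(tau0 <= tau < m) (in_operation env q0 u t tau0 tau)%:R <=
  x + 1 + \sum_(tau0 <= tau < m)
    (in_operation env q0 u t tau0 tau && trying (thread (cfg u tau) t))%:R *
    (4 - (x - 2) * (free (cfg u tau) t)%:R).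
Proof.
move=> x6 t0m [r idle]; set f := BIG_F.
set g := (X in _ <= _ + \sum_(_ <= i < _) X i).
suff : \sum_(tau0 <= tau < m) f tau + remaining x u t tau0 m <=
       x + 1 + \sum_(tau0 <= tau < m) g tau.
  by have := remaining_ge0 u t tau0 m x6; lra.
have base m' : tau0 = m' -> \sum_(tau0 <= tau < m') f tau +
    remaining x u t tau0 m' <= x + 1 + \sum_(tau0 <= tau < m') g tau.
  move=> <-; rewrite !big_geq // add0r addr0 /remaining.
  by case: ifP => _; rewrite ?idle //=; lra.
elim: m t0m => [|m IH]; first by rewrite leqn0 => /eqP/base.
rewrite leq_eqVlt => /orP[/eqP/base //|t0m].
have step : f m + remaining x u t tau0 m.+1 <= remaining x u t tau0 m + g m.
  exact: remaining_step.
rewrite !big_nat_recr //=; have := IH t0m; move: step.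
lra.
Qed.

Lemma determined_and tau0 tau (A G : (nat * bool -> 'I_n) -> bool) :
  (tau0 <= tau)%N -> determined tau0 A -> determined tau G ->
  determined tau (fun u => A u && G u).
Proof.
by move=> t0 dA dG u v h; rewrite (dG _ _ h) (dA u v) //; apply: history_le h.
Qed.

Lemma n_gt0 : (0 < n)%N.
Proof. by apply: leq_ltn_trans (ltn_ord i0). Qed.

Lemma card_sumr (Q : pred draws) :
  #|[set w | Q w]%SET|%:R = \sum_w (Q w)%:R :> R.
Proof.
rewrite -sum1dep_card natr_sum big_mkcond.
by apply: eq_bigr => w _; case: (Q w).
Qed.

Lemma expected_steps (x : R) t tau0 m (A : (nat * bool -> 'I_n) -> bool) :
  6 <= x -> 4 * n%:R ^+ 2 <= (x - 2) * (n - p)%N%:R ^+ 2 ->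
  (tau0 <= m <= N)%N -> determined tau0 A ->
  (forall u, A u -> exists r, thread (cfg u tau0) t = Idle r) ->
  \sum_(w : draws | A (extend w)) \sum_(tau0 <= tau < m)
    (in_operation env q0 (extend w) t tau0 tau)%:R <=
  (x + 1) * #|[set w : draws | A (extend w)]%SET|%:R.
Proof.
move=> x6 xn /andP[t0m mN] dA idle.
apply: le_trans (ler_sum _ (fun w Aw => sum_in_operation x6 t0m (idle _ Aw))) _.
rewrite big_split /= sumr_const -(cardsE (fun w => A (extend w))) mulr_natr.
rewrite gerDl.
(* The corrections are nonpositive on average at each single time: [sum_free] bounds the success
   probability below by [((n - p) / n) ^ 2], hence by [4 / (x - 2)]. *)
rewrite exchange_big /= big_nat_cond; apply: sumr_le0 => tau.
rewrite andbT => /andP[t0 tm].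
pose G u := A u && (in_operation env q0 u t tau0 tau &&
                    trying (thread (cfg u tau) t)).
have dG : determined tau G.
  apply: determined_and t0 dA _; apply: determined_and (leqnn _) _ _.
    exact: in_operation_determined.
  by move=> u v h; apply: hide_trying (history_hide t h).
have Gt u : G u -> trying (thread (cfg u tau) t) by case/and3P.
have := sum_free (leq_trans (ltnW tm) mN) dG Gt.
set g := #|_|; set gf := #|_| => gfP.
rewrite (_ : \sum_(_ | _) _ = 4 * g%:R - (x - 2) * gf%:R); last first.
  rewrite !card_sumr !big_distrr -sumrB /= big_mkcond; apply: eq_bigr => w _.
  rewrite /G; case: (A (extend w)) => /=; last by rewrite !mulr0 subr0.
  by case: (_ && _) => /=; rewrite ?mul0r ?mul1r ?mulr0 ?mulr1 ?subr0.
have n0 : 0 < n%:R ^+ 2 :> R by rewrite exprn_gt0 // ltr0n n_gt0.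
have {}gfP : (n - p)%N%:R ^+ 2 * g%:R <= n%:R ^+ 2 * gf%:R :> R.
  by rewrite -!natrX -!natrM ler_nat.
rewrite subr_le0 -(ler_pM2l n0).
apply: (@le_trans _ _ ((x - 2) * ((n - p)%N%:R ^+ 2 * g%:R))).
  by rewrite [leLHS]mulrCA [leLHS]mulrA [leRHS]mulrA ler_wpM2r.
by rewrite [leRHS]mulrCA; apply: ler_wpM2l => //; lra.
Qed.

(** Whether the step at [tau] belongs to the operation is determined by the history, so at each time
    the contention bound applies conditionally on this and turns costs into numbers of steps. *)
Lemma expected_cost (a b x : R) t tau0 m (A : (nat * bool -> 'I_n) -> bool) :
  0 <= b -> (p <= n)%N ->
  6 <= x -> 4 * n%:R ^+ 2 <= (x - 2) * (n - p)%N%:R ^+ 2 ->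
  (tau0 <= m <= N)%N -> determined tau0 A -> 0 <= a ->
  (forall u, A u -> exists r, thread (cfg u tau0) t = Idle r) ->
  \sum_(w : draws | A (extend w)) \sum_(tau0 <= tau < m)
    (in_operation env q0 (extend w) t tau0 tau)%:R *
    (a + b * (own_contention (cfg (extend w) tau) t)%:R) <=
  (a + b * 5) * (x + 1) * #|[set w : draws | A (extend w)]%SET|%:R.
Proof.
move=> b0 pn x6 xn t0mN dA a0 idle.
apply: (@le_trans _ _ ((a + b * 5) * \sum_(w : draws | A (extend w))
   \sum_(tau0 <= tau < m) (in_operation env q0 (extend w) t tau0 tau)%:R));
  last first.
  rewrite -[leRHS]mulrA; apply: ler_wpM2l; first by lra.
  exact: expected_steps.
rewrite [leLHS]exchange_big [X in _ <= _ * X]exchange_big /= big_distrr /=.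
move/andP: t0mN => [_ mN].
apply: ler_sum_nat => tau /andP[t0 tm].
pose G u := A u && in_operation env q0 u t tau0 tau.
have dG : determined tau G.
  by apply: determined_and t0 dA _; apply: in_operation_determined.
have := sum_contention t (leq_trans (ltnW tm) mN) dG.
set g := #|_|; set s := (\sum_(w | _) _)%N => sP.
(* [n + 4 * p <= 5 * n] because [p <= n]. *)
have {}sP : (s <= 5 * g)%N.
  rewrite -(leq_pmul2l n_gt0) (leq_trans sP) // mulnA leq_mul2r.
  apply/orP; right.
  lia.
rewrite (_ : \sum_(w | _) _ = a * g%:R + b * s%:R); last first.
  rewrite /s natr_sum card_sumr !big_distrr [X in _ + X]big_mkcond -big_split.
  rewrite /= big_mkcond; apply: eq_bigr => w _.
  rewrite /G; case: (A _) => /=; last by rewrite mulr0 addr0.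
  by case: in_operation; rewrite ?mul1r ?mul0r ?mulr1 ?mulr0 ?addr0.
rewrite (_ : \sum_(w | _) _ = g%:R); last first.
  rewrite card_sumr big_mkcond; apply: eq_bigr => w _.
  by rewrite /G; case: (A _).
rewrite mulrDl lerD2l -mulrA; apply: ler_wpM2l => //.
by rewrite -natrM ler_nat.
Qed.

End Draws.

End Dynamics.

(** * Events depending on finitely many draws *)

Section Cylinders.
Context {d : measure_display} {T : measurableType d} {R : realType}.
Variables (P : probability T R) (n : nat) (U : nat * bool -> T -> 'I_n).
Hypotheses (hU : forall k, uniform_draw P (U k)) (hI : independent_family P U).
Variables (i0 : 'I_n) (N : nat).
Local Notation draws := {ffun 'I_N * bool -> 'I_n}.
Local Notation ext := (extend i0).

Definition prefix_only (V : Type) (F : (nat * bool -> 'I_n) -> V) : Prop :=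
  forall u v, (forall k b, (k < N)%N -> u (k, b) = v (k, b)) -> F u = F v.

Let indices : seq (nat * bool) :=
  [seq (val x.1, x.2) | x <- enum {: 'I_N * bool}].

(** The cylinders partition the probability space into events of equal probability [mass], which
    turns integrals into the counting sums above. *)
Definition cylinder (w : draws) : set T :=
  \bigcap_(k in [set` indices]) (U k @^-1` [set ext w k]).

Definition draws_of (z : T) : draws := [ffun x => U (val x.1, x.2) z].

Lemma cylinderP w z : cylinder w z <-> draws_of z = w.
Proof.
split=> [cw|<- k /= /mapP[[x b] _ ->]].
  apply/ffunP => -[k b]; rewrite ffunE /=.
  have /cw /= -> : [set` indices] (val k, b).
    by apply/mapP; exists (k, b) => //; rewrite mem_enum.
  by rewrite /extend /= valK.
by rewrite /extend /= valK ffunE.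
Qed.

Lemma prefix_only_draws (V : Type) (F : (nat * bool -> 'I_n) -> V) z :
  prefix_only F -> F (U ^~ z) = F (ext (draws_of z)).
Proof.
by apply=> k b kN; rewrite /extend /= insubT /= ffunE.
Qed.

Lemma measurable_cylinder w : measurable (cylinder w).
Proof.
apply: fin_bigcap_measurable => // k _.
by have [] := hU k (ext w k).
Qed.

Lemma cylinder_prob w :
  P (cylinder w) = (\prod_(k <- indices) (n%:R^-1 : R)%:E)%E.
Proof.
rewrite /cylinder (hI (fun k => [set ext w k])).
  by apply: eq_bigr => k _; have [] := hU k (ext w k).
rewrite map_inj_uniq ?enum_uniq // => -[k b] [k' b'] /= [/val_inj -> ->].
by [].
Qed.

Definition mass : R := \prod_(k <- indices) n%:R^-1.

Lemma massE w : P (cylinder w) = mass%:E.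
Proof. by rewrite cylinder_prob prodEFin. Qed.

Lemma mass_ge0 : 0 <= mass.
Proof. by apply: prodr_ge0 => k _; rewrite invr_ge0. Qed.

(** Representation as a simple function, from which both measurability and the integral follow. *)
Lemma prefix_only_sum (F : (nat * bool -> 'I_n) -> R) z : prefix_only F ->
  F (U ^~ z) = \sum_(w : draws) F (ext w) * \1_(cylinder w) z.
Proof.
move=> pF; rewrite (prefix_only_draws z pF) (bigD1 (draws_of z)) //=.
rewrite indicE mem_set ?mulr1; last exact/cylinderP.
rewrite big1 ?addr0 // => w wz; rewrite indicE memNset ?mulr0 //.
by move/cylinderP => zw; rewrite zw eqxx in wz.
Qed.

Lemma measurable_prefix_only (F : (nat * bool -> 'I_n) -> R) (D : set T) :
  prefix_only F -> measurable_fun D (fun z => F (U ^~ z)).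
Proof.
move=> pF; under eq_fun do rewrite (prefix_only_sum _ pF).
apply: measurable_sum => w; apply: measurable_funM; first exact: measurable_cst.
by apply: measurable_indic; apply: measurable_cylinder.
Qed.

Lemma measurable_prefix_event (Q : (nat * bool -> 'I_n) -> bool) :
  prefix_only Q -> measurable [set z | Q (U ^~ z)].
Proof.
move=> pQ.
rewrite (_ : [set _ | _] =
  \bigcup_(w in [set w : draws | Q (ext w)]) cylinder w).
  by apply: fin_bigcup_measurable => // w _; apply: measurable_cylinder.
apply/seteqP; split=> z /=.
  rewrite (prefix_only_draws z pQ) => h; exists (draws_of z) => //.
  exact/cylinderP.
by move=> [w /= Qw /cylinderP zw]; rewrite (prefix_only_draws z pQ) zw.
Qed.

Lemma integral_prefix_only (F : (nat * bool -> 'I_n) -> R)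
    (Q : (nat * bool -> 'I_n) -> bool) :
  prefix_only F -> prefix_only Q -> (forall u, 0 <= F u) ->
  (\int[P]_(z in [set z | Q (U ^~ z)]) (F (U ^~ z))%:E =
   (mass * \sum_(w : draws | Q (ext w)) F (ext w))%:E)%E.
Proof.
move=> pF pQ F0; have mA := measurable_prefix_event pQ.
under eq_integral do rewrite (prefix_only_sum _ pF) -sumEFin.
rewrite ge0_integral_sum //=; last 2 first.
- move=> w; apply/measurable_EFinP; apply: measurable_funM.
    exact: measurable_cst.
  by apply: measurable_indic; apply: measurable_cylinder.
- by move=> w z _; rewrite lee_fin mulr_ge0.
rewrite big_distrr /= -sumEFin [RHS]big_mkcond /=; apply: eq_bigr => w _.
under eq_integral do rewrite EFinM.
rewrite ge0_integralZl //; last first.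
- by rewrite lee_fin.
- apply/measurable_EFinP; apply: measurable_indic.
  exact: measurable_cylinder.
rewrite integral_indic //; last exact: measurable_cylinder.
case: ifPn => Qw.
  rewrite setIidl; first by rewrite mulrC EFinM -(massE w).
  by move=> z /cylinderP zw /=; rewrite (prefix_only_draws z pQ) zw.
rewrite (_ : _ `&` _ = set0) ?measure0 ?mule0 //.
apply/seteqP; split => // z [/cylinderP zw /=].
by rewrite (prefix_only_draws z pQ) zw (negPf Qw).
Qed.

Lemma prob_prefix_event (Q : (nat * bool -> 'I_n) -> bool) : prefix_only Q ->
  P [set z | Q (U ^~ z)] =
  (mass * #|[set w : draws | Q (ext w)]%SET|%:R)%:E.
Proof.
move=> pQ; have mA := measurable_prefix_event pQ.
have := integral_prefix_only (F := fun=> 1) (fun _ _ _ => erefl) pQ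
  (fun=> ler01).
rewrite sumr_const -(cardsE (fun w => Q (ext w))) => <-.
by rewrite -[LHS]mul1e; apply/esym/integral_cst.
Qed.

End Cylinders.

(** * Dependence of executions on finitely many draws *)

Section Measurability.
Context {R : realType} {dK : Order.disp_t} {K : orderType dK} {E : eqType}
  {key : E -> K} {pq : seq_pq R key} {p n : nat}.
Variables (env : environment pq (p := p) (n := n)) (q0 : 'I_n -> pq_state pq).

Lemma prefix_only_config N tau (V : Type)
    (F : config pq (p := p) (n := n) -> V) :
  (tau <= N)%N -> prefix_only N (fun u => F (config_at env q0 u tau)).
Proof.
move=> tN u v uv; rewrite /config_at (@run_prefix _ _ _ _ _ _ _ _ _ _ u v) //.
by move=> k b kt; apply: uv; apply: leq_trans tN.
Qed.

Lemma prefix_only_determined N tau G : (tau <= N)%N ->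
  determined env q0 tau G -> prefix_only (n := n) N G.
Proof.
move=> tN dG u v uv; apply: dG; rewrite /history.
rewrite (@run_prefix _ _ _ _ _ _ _ _ _ _ u v) //.
by move=> k b kt; apply: uv; apply: leq_trans tN.
Qed.

(** Idleness is visible since [hide] conceals nothing of an idle thread. *)
Lemma starts_determined (t : 'I_p) o tau0 (H : set (seq (view pq))) :
  determined env q0 tau0
    (fun u => `[< starts env q0 u t o tau0 /\ H (history env q0 u tau0) >]).
Proof.
have sub u v : history env q0 u tau0 = history env q0 v tau0 ->
    starts env q0 u t o tau0 /\ H (history env q0 u tau0) ->
    starts env q0 v t o tau0 /\ H (history env q0 v tau0).
  move=> h [[e [r idle]] Hu]; rewrite /starts -h; split => //; split => //.
  exists r; have := history_hide t h; rewrite idle /=.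
  by case: (thread (config_at env q0 v tau0) t) => //= r' [->].
by move=> u v h; apply: asbool_equiv_eq; split; apply: sub.
Qed.

Lemma step_timeE a b (s : config pq (p := p) (n := n)) (t : 'I_p) :
  step_time a b s t = (a + b * (own_contention s t)%:R) + access_time s t.
Proof.
by rewrite /step_time /own_contention; case: next_location => //; rewrite mulr0.
Qed.

Lemma access_time_ge0 (s : config pq (p := p) (n := n)) t :
  0 <= access_time s t.
Proof.
rewrite /access_time; case: (thread s t) => // -[e|] k.
  exact: pq_insert_time_ge0.
exact: pq_deletemin_time_ge0.
Qed.

End Measurability.

(** * Integration over the probability space *)

Theorem theorem1 (R : realType) (c : R) (hc : 1 < c)
    (a b : R) (ha : 0 <= a) (hb : 0 <= b) :
  exists C : R,
  forall (p n : nat) (hp : (1 <= p)%N) (hn : n%:R = c * p%:R)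
    (dK : Order.disp_t) (K : orderType dK) (E : eqType) (key : E -> K)
    (pq : seq_pq R key) (q0 : 'I_n -> pq_state pq)
    (env : environment pq (p := p))
    (d : measure_display) (T : measurableType d) (P : probability T R)
    (U : nat * bool -> T -> 'I_n)
    (hU : forall k, uniform_draw P (U k)) (hI : independent_family P U)
    (t : 'I_p) (o : operation E) (tau0 : nat) (H : set (seq (view pq))),
  let A := [set w | starts env q0 (U ^~ w) t o tau0 /\
                    H (history env q0 (U ^~ w) tau0)] in
  (\int[P]_(w in A) operation_time env q0 (U ^~ w) a b t tau0 <=
   C%:E * P A +
   \int[P]_(w in A) sequential_access_time env q0 (U ^~ w) t tau0)%E.
Proof.
(* Chosen so that [4 / (x - 2)] equals the success bound [(1 - 1 / c) ^ 2]. *)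
pose x := 2 + 4 * (c / (c - 1)) ^+ 2.
have c1 : 0 < c - 1 by rewrite subr_gt0.
have x6 : 6 <= x.
  rewrite /x; have : 1 <= c / (c - 1) by rewrite ler_pdivlMr // mul1r; lra.
  by move=> /(exprn_ege1 2); lra.
(* Expected cost [a + b * 5] per step times the bound [x + 1] for the expected number of steps. *)
exists ((a + b * 5) * (x + 1)) => p n hp hn dK K E key pq q0 env d T P U hU hI
  t o tau0 H; lazy zeta; set A := [set w | _].
have p0 : 0 < p%:R :> R by rewrite ltr0n.
have pn : (p <= n)%N by rewrite -(ler_nat R) hn ler_peMl // ltW.
have i0 : 'I_n := Ordinal (leq_trans hp pn).
have xn : 4 * n%:R ^+ 2 <= (x - 2) * (n - p)%N%:R ^+ 2.
  rewrite natrB // hn /x addrC addKr -mulrA ler_pM2l // -exprMn.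
  rewrite (_ : c * p%:R - p%:R = (c - 1) * p%:R); last by rewrite mulrBl mul1r.
  by rewrite mulrA divfK // gt_eqF.
pose Q u := `[< starts env q0 u t o tau0 /\ H (history env q0 u tau0) >].
have dQ : determined env q0 tau0 Q by apply: starts_determined.
have AQ : A = [set z | Q (U ^~ z)].
  by apply/seteqP; split => z /=; rewrite /Q; [move/asboolP|move/asboolP].
have Qidle u : Q u -> exists r, thread (config_at env q0 u tau0) t = Idle r.
  by move/asboolP => [[]].
pose inop tau u := in_operation env q0 u t tau0 tau.
(* [f] collects local work and contention, [g] the sequential access. *)
pose f tau u := (inop tau u)%:R *
  (a + b * (own_contention (config_at env q0 u tau) t)%:R).
pose g tau u := (inop tau u)%:R * access_time (config_at env q0 u tau) t.
have f0 tau u : 0 <= f tau u by rewrite mulr_ge0 // addr_ge0 // mulr_ge0.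
have g0 tau u : 0 <= g tau u by rewrite mulr_ge0 // access_time_ge0.
have pI N tau : (tau <= N)%N -> prefix_only N (inop tau).
  move=> tN; apply: prefix_only_determined tN _.
  exact: in_operation_determined.
have pf N tau : (tau <= N)%N -> prefix_only N (f tau).
  move=> tN u v uv; rewrite /f (pI N tau tN u v uv).
  by rewrite (prefix_only_config env q0 (fun s => own_contention s t) tN uv).
have pg N tau : (tau <= N)%N -> prefix_only N (g tau).
  move=> tN u v uv; rewrite /g (pI N tau tN u v uv).
  by rewrite (prefix_only_config env q0 (fun s => access_time s t) tN uv).
have pQ N : (tau0 <= N)%N -> prefix_only N Q.
  by move=> tN; apply: prefix_only_determined dQ.
have mA : measurable A.
  by rewrite AQ; apply: (measurable_prefix_event hU i0 (pQ _ (leqnn _))).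
have mf tau : measurable_fun A (fun z => (f tau (U ^~ z))%:E).
  apply/measurable_EFinP.
  exact: (measurable_prefix_only hU i0 (pf _ _ (leqnn _))).
have mg tau : measurable_fun A (fun z => (g tau (U ^~ z))%:E).
  apply/measurable_EFinP.
  exact: (measurable_prefix_only hU i0 (pg _ _ (leqnn _))).
have opE z : operation_time env q0 (U ^~ z) a b t tau0 =
    (\sum_(0 <= tau <oo) (f tau (U ^~ z))%:E +
     \sum_(0 <= tau <oo) (g tau (U ^~ z))%:E)%E.
  rewrite -nneseriesD; try by move=> *; rewrite lee_fin.
  rewrite /operation_time eseries_mkcond; apply: eq_eseriesr => tau _.
  rewrite /f /g /inop step_timeE -EFinD.
  by case: in_operation; rewrite ?mul1r // !mul0r addr0.
have sqE z : sequential_access_time env q0 (U ^~ z) t tau0 =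
    (\sum_(0 <= tau <oo) (g tau (U ^~ z))%:E)%E.
  rewrite /sequential_access_time eseries_mkcond; apply: eq_eseriesr => tau _.
  by rewrite /g /inop; case: in_operation; rewrite ?mul1r // !mul0r.
under eq_integral do rewrite opE.
under [X in (_ <= _ + X)%E]eq_integral do rewrite sqE.
rewrite ge0_integralD //; last 4 first.
- by move=> z _; apply: nneseries_ge0 => *; rewrite lee_fin.
- by apply: ge0_emeasurable_sum => // *; rewrite lee_fin.
- by move=> z _; apply: nneseries_ge0 => *; rewrite lee_fin.
- by apply: ge0_emeasurable_sum => // *; rewrite lee_fin.
(* The sequential access times cancel, even if their integral is infinite. *)
apply: leeD2r.
(* By monotone convergence it suffices to bound the partial sums up to [m], which depend on the
   draws before time [m] only; so [N] is taken to be [m]. *)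
rewrite integral_nneseries //; last by move=> *; rewrite lee_fin.
apply: lime_le.
  apply: is_cvg_nneseries => tau _ _; apply: integral_ge0 => z _.
  by rewrite lee_fin.
near=> m.
have t0m : (tau0 <= m)%N by near: m; exact: nbhs_infty_ge.
rewrite AQ (prob_prefix_event hU hI i0 (pQ _ t0m)) /=.
under eq_big_nat => tau /andP[_ tm] do
  rewrite (integral_prefix_only hU hI i0 (pf _ _ (ltnW tm)) (pQ _ t0m)
    (f0 tau)).
rewrite sumEFin -EFinM lee_fin -big_distrr /= mulrCA.
apply: ler_wpM2l; first exact: mass_ge0.
rewrite exchange_big /=.
have := @expected_cost _ _ _ _ _ _ _ _ env q0 i0 m a b x t tau0 m Q hb pn x6 xn.
rewrite t0m leqnn => /(_ isT dQ ha Qidle).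
apply: le_trans; apply: ler_sum => w _.
(* Times before [tau0] contribute nothing. *)
rewrite (big_cat_nat (leq0n tau0) t0m) /= [X in X + _]big_nat_cond.
rewrite big1 ?add0r //.
move=> tau; rewrite andbT => /andP[_ tt0].
by rewrite /f /inop /in_operation leqNgt tt0 mul0r.
Unshelve. all: by end_near.
Qed.
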